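(* For any left canonical matrix $V$ for $T$ at $\lambda_0$ there exists a right canonical matrix $Y$ for $T$ at $\lambda_0$ satisfying the biorthogonality condition $\Delta^{-1}VTY\Delta^{-1}\doteq\Delta^{-1}$. Such a right canonical matrix is determined uniquely up to addition of a matrix of the form $H\Delta$ with $H\in\mathcal{H}^{n\times r}$. For any right canonical $Y$ satisfying the biorthogonality condition with $V$, one has $T^{-1}\doteq Y\Delta^{-1}V$.
   Context: Let $\Omega\subset\mathbb{C}$ be open and $\lambda_0\in\Omega$ fixed. $\mathcal{H}$ denotes the ring of holomorphic functions on $\Omega$, and $\mathcal{H}_0$ the ring of functions holomorphic in some neighborhood of $\lambda_0$. Write $\chi_0(\lambda)=\lambda-\lambda_0$. A matrix $M\in\mathcal{H}_0^{n\times n}$ is unimodular if it has an inverse in $\mathcal{H}_0^{n\times n}$. For meromorphic matrices $M_1,M_2$ of equal size, $M_1\doteq M_2$ means that $M_2-M_1$ is holomorphic in a neighborhood of $\lambda_0$. Throughout, $T\in\mathcal{H}^{n\times n}$ with $\det T$ not identically zero and $\det T(\lambda_0)=0$, and $r=\dim\ker T(\lambda_0)$. There exist unimodular $U_L,U_R\in\mathcal{H}_0^{n\times n}$ and uniquely determined integers $m_1\ge\cdots\ge m_n\ge 0$ (the partial multiplicities) with $U_LTU_R=\mathrm{diag}(\chi_0^{m_1},\dots,\chi_0^{m_n})$; $m_i>0$ exactly for $i\le r$. Set $\Delta=\mathrm{diag}(\chi_0^{m_1},\dots,\chi_0^{m_r})$. A root function for $T$ at $\lambda_0$ is $y\in\mathcal{H}^n$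 with $y(\lambda_0)\neq0$ and $T(\lambda_0)y(\lambda_0)=0$; its multiplicity $\nu(y)$ is the order of the zero of $Ty$ at $\lambda_0$. A right canonical matrix for $T$ at $\lambda_0$ is $Y\in\mathcal{H}^{n\times r}$ whose columns $y_1,\dots,y_r$ are root functions such that (a) $y_1(\lambda_0),\dots,y_r(\lambda_0)$ are linearly independent, (b) $\sum_{i=1}^r\nu(y_i)=\sum_{i=1}^r m_i$, (c) $\nu(y_1)\ge\cdots\ge\nu(y_r)$. A left root function is a row vector $v\in\mathcal{H}^{1\times n}$ with $v(\lambda_0)\ne0$ and $v(\lambda_0)T(\lambda_0)=0$, with multiplicity the order of the zero of $vT$ at $\lambda_0$; a left canonical matrix $V\in\mathcal{H}^{r\times n}$ is defined analogously. *)

(* Defs.v *)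
From mathcomp Require Import all_boot all_order all_algebra.
From mathcomp Require Import complex.
From mathcomp Require Import reals.
Set Implicit Arguments.
Unset Strict Implicit.
Unset Printing Implicit Defensive.
Import Order.TTheory GRing.Theory Num.Theory.
Local Open Scope ring_scope.

Section Defs.
Variable R : realType.
Local Notation C := R[i].

Definition openC (U : C -> Prop) : Prop :=
  forall z, U z -> exists d : C, 0 < d /\ forall w, `|w - z| < d -> U w.

Definition nearC (z0 : C) (P : C -> Prop) : Prop :=
  exists d : C, 0 < d /\ forall z, `|z - z0| < d -> P z.

Definition cderiv_at (f : C -> C) (z f' : C) : Prop :=
  forall e : C, 0 < e -> exists d : C, 0 < d /\
    forall h : C, h != 0 -> `|h| < d -> `|(f (z + h) - f z) / h - f'| < e.

Definition holo_on (U : C -> Prop) (f : C -> C) : Prop :=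
  forall z, U z -> exists f', cderiv_at f z f'.

Definition mholo_on (p q : nat) (U : C -> Prop) (F : C -> 'M[C]_(p, q)) : Prop :=
  forall i j, holo_on U (fun z => F z i j).

Definition mholo_near (p q : nat) (z0 : C) (F : C -> 'M[C]_(p, q)) : Prop :=
  exists U, openC U /\ U z0 /\ mholo_on U F.

Definition unimodular (n : nat) (z0 : C) (M : C -> 'M[C]_n) : Prop :=
  mholo_near z0 M /\ exists N : C -> 'M[C]_n, mholo_near z0 N /\
    nearC z0 (fun z => M z *m N z = 1%:M /\ N z *m M z = 1%:M).

Definition partial_multiplicities (n : nat) (z0 : C) (T : C -> 'M[C]_n)
    (m : nat -> nat) : Prop :=
  (forall i j, (i <= j < n)%N -> (m j <= m i)%N) /\
  exists UL UR : C -> 'M[C]_n, unimodular z0 UL /\ unimodular z0 UR /\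
    nearC z0 (fun z => UL z *m T z *m UR z
                       = diag_mx (\row_(i < n) (z - z0) ^+ m i)).

Definition zero_order (p q : nat) (z0 : C) (g : C -> 'M[C]_(p, q)) (k : nat) : Prop :=
  exists h : C -> 'M[C]_(p, q), mholo_near z0 h /\ h z0 != 0 /\
    nearC z0 (fun z => g z = (z - z0) ^+ k *: h z).

Definition root_fun (n : nat) (Om : C -> Prop) (z0 : C) (T : C -> 'M[C]_n)
    (y : C -> 'cV[C]_n) (k : nat) : Prop :=
  mholo_on Om y /\ y z0 != 0 /\ T z0 *m y z0 = 0 /\
  zero_order z0 (fun z => T z *m y z) k.

Definition lroot_fun (n : nat) (Om : C -> Prop) (z0 : C) (T : C -> 'M[C]_n)
    (v : C -> 'rV[C]_n) (k : nat) : Prop :=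
  mholo_on Om v /\ v z0 != 0 /\ v z0 *m T z0 = 0 /\
  zero_order z0 (fun z => v z *m T z) k.

Definition right_canonical (n r : nat) (Om : C -> Prop) (z0 : C)
    (T : C -> 'M[C]_n) (m : nat -> nat) (Y : C -> 'M[C]_(n, r)) : Prop :=
  mholo_on Om Y /\
  exists nu : nat -> nat,
    (forall i : 'I_r, root_fun Om z0 T (fun z => col i (Y z)) (nu i)) /\
    \rank (Y z0) = r /\
    (\sum_(i < r) nu i = \sum_(i < r) m i)%N /\
    (forall i j, (i <= j < r)%N -> (nu j <= nu i)%N).

Definition left_canonical (n r : nat) (Om : C -> Prop) (z0 : C)
    (T : C -> 'M[C]_n) (m : nat -> nat) (V : C -> 'M[C]_(r, n)) : Prop :=
  mholo_on Om V /\
  exists nu : nat -> nat,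
    (forall i : 'I_r, lroot_fun Om z0 T (fun z => row i (V z)) (nu i)) /\
    \rank (V z0) = r /\
    (\sum_(i < r) nu i = \sum_(i < r) m i)%N /\
    (forall i j, (i <= j < r)%N -> (nu j <= nu i)%N).

Definition Delta (r : nat) (z0 : C) (m : nat -> nat) (z : C) : 'M[C]_r :=
  diag_mx (\row_(i < r) (z - z0) ^+ m i).

(* Delta^{-1} (meaningful for z <> z0) *)
Definition Delta_inv (r : nat) (z0 : C) (m : nat -> nat) (z : C) : 'M[C]_r :=
  diag_mx (\row_(i < r) ((z - z0)^-1) ^+ m i).

(* M1 ≐ M2 : meromorphic matrices (given pointwise off their poles) whose
   difference M2 - M1 is holomorphic in a neighborhood of z0, i.e. agrees on a
   punctured neighborhood of z0 with a function holomorphic near z0. *)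
Definition mero_eq (p q : nat) (z0 : C) (M1 M2 : C -> 'M[C]_(p, q)) : Prop :=
  exists G : C -> 'M[C]_(p, q), mholo_near z0 G /\
    nearC z0 (fun z => z != z0 -> M2 z - M1 z = G z).

End Defs.

(* Main.v *)
Require Import Defs.
From mathcomp Require Import all_boot all_order all_algebra.
From mathcomp Require Import complex.
From mathcomp Require Import reals.
From mathcomp Require Import fingroup perm.
From mathcomp Require Import ring.
Import Order.TTheory GRing.Theory Num.Theory.
Local Open Scope ring_scope.

(** Completing [V] by constant rows [E] to [P = [V; E]], invertible at [z0], and
    writing [V T = Delta W], one gets [P T = diag(Delta, 1) Q] with [Q = [W; E T]];
    comparing determinants, [Q] is invertible at [z0], and the multiplicities of [V]
    are those of [T] by uniqueness of the local Smith form.  The right canonical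
    matrices biorthogonal to [V] are then exactly the holomorphic [Y] with
    [Q Y = [1; 0] + K Delta], [K] holomorphic near [z0].  Two solutions differ by
    [H Delta] with [H = Q^-1 (K' - K)], and
    [T^-1 = Q^-1 diag(Delta^-1, 1) P = Y Delta^-1 V] modulo holomorphic terms.

    Functions are only assumed to be complex differentiable, and Taylor
    expansions are not needed to obtain a solution on all of [Om]: if [N] is
    holomorphic and vanishes at [z0], then [N^(k+1)] is [(z - z0)^k] times a
    holomorphic function, so a truncated Neumann series inverts [Q] to any order. *)

Set Implicit Arguments.
Unset Strict Implicit.
Unset Printing Implicit Defensive.

(** * Continuity and complex differentiability at a point *)

Section LocalFunctions.
Variable R : realType.
Local Notation C := R[i].
Implicit Types (z : C) (f g : C -> C) (P Q : C -> Prop).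

Lemma near_center z P : nearC z P -> P z.
Proof. by move=> [d [d0]]; apply; rewrite subrr normr0. Qed.

Lemma nearW z P : (forall w, P w) -> nearC z P.
Proof. by move=> h; exists 1; split. Qed.

Lemma near_mono z P Q : (forall w, P w -> Q w) -> nearC z P -> nearC z Q.
Proof. by move=> PQ [d [d0 h]]; exists d; split=> // w /h /PQ. Qed.

Lemma near_and z P Q : nearC z P -> nearC z Q -> nearC z (fun w => P w /\ Q w).
Proof.
move=> [d [d0 hd]] [e [e0 he]].
(* The order on [R[i]] is partial, but positive radii are real and hence comparable. *)
have /orP[de|ed] := real_leVge (gtr0_real d0) (gtr0_real e0).
- by exists d; split=> // w wd; split; [exact: hd|apply: he; apply: lt_le_trans de].
- by exists e; split=> // w wd; split; [apply: hd; apply: lt_le_trans ed|exact: he].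
Qed.

Lemma near_mono2 z P Q S :
  (forall w, P w -> Q w -> S w) -> nearC z P -> nearC z Q -> nearC z S.
Proof. by move=> h hP hQ; apply: near_mono (near_and hP hQ) => w []; exact: h. Qed.

Lemma near_forall (I : finType) z (P : I -> C -> Prop) :
  (forall i, nearC z (P i)) -> nearC z (fun w => forall i, P i w).
Proof.
move=> h; suff: forall s : seq I, nearC z (fun w => forall i, i \in s -> P i w).
  by move=> /(_ (enum I)); apply: near_mono => w hw i; apply: hw; rewrite mem_enum.
elim=> [|i s IH]; first exact: nearW.
apply: near_mono2 (h i) IH => w hi hs j.
by rewrite inE => /orP[/eqP ->|] //; exact: hs.
Qed.

Lemma near_near z P : nearC z P -> nearC z (fun w => nearC w P).
Proof.
move=> [d [d0 h]]; exists d; split=> // w wd; exists (d - `|w - z|).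
split=> [|v vw]; first by rewrite subr_gt0.
apply: h; rewrite -(subrKA w).
by apply: le_lt_trans (ler_normD _ _) _; rewrite -ltrBrDr.
Qed.

Lemma near_neq z w : w != z -> nearC w (fun v => v != z).
Proof.
move=> wz; exists `|w - z|; split=> [|v]; first by rewrite normr_gt0 subr_eq0.
by apply: contraTneq => ->; rewrite distrC ltxx.
Qed.

Definition ccont z f := forall e, 0 < e -> nearC z (fun w => `|f w - f z| < e).

Definition cdiff z f := exists l, cderiv_at f z l.

Definition hol z f := nearC z (fun w => cdiff w f).

Lemma ccont_near z f g :
  ccont z f -> nearC z (fun w => f w = g w) -> ccont z g.
Proof.
move=> cf fg e e0; by apply: near_mono2 (cf e e0) (fg) => w h <-; rewrite -(near_center fg).
Qed.

Lemma cdiff_near z f g :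
  cdiff z f -> nearC z (fun w => f w = g w) -> cdiff z g.
Proof.
move=> [l df] fg; exists l => e e0.
have [d [d0 hd]] := df _ e0; have [d' [d'0 hd']] := fg.
have [c [c0 hc]] : nearC 0 (fun h => `|h| < d /\ `|h| < d').
  by apply: near_and; [exists d|exists d']; split=> // h; rewrite subr0.
exists c; split=> // h h0; rewrite -[h in `|h| < _]subr0 => /hc[h1 h2].
rewrite -(near_center fg) -hd'; first exact: hd.
by rewrite addrC addKr.
Qed.

Lemma hol_near z f g : hol z f -> nearC z (fun w => f w = g w) -> hol z g.
Proof.
by move=> hf /near_near fg; apply: near_mono2 hf fg => w; exact: cdiff_near.
Qed.

Lemma ccont_const z c : ccont z (fun=> c).
Proof. by move=> e e0; apply: nearW => w; rewrite subrr normr0. Qed.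

Lemma ccont_id z : ccont z id.
Proof. by move=> e e0; exists e; split. Qed.

Lemma ccontD z f g : ccont z f -> ccont z g -> ccont z (fun w => f w + g w).
Proof.
move=> cf cg e e0; have e20 : 0 < e / 2%:R by rewrite divr_gt0 // ltr0n.
apply: near_mono2 (cf _ e20) (cg _ e20) => w hf hg.
rewrite opprD addrACA (splitr e).
exact: le_lt_trans (ler_normD _ _) (ltrD hf hg).
Qed.

Lemma ccontM z f g : ccont z f -> ccont z g -> ccont z (fun w => f w * g w).
Proof.
move=> cf cg e e0.
have a0 : 0 < `|g z| + 1 by rewrite ltr_wpDl.
have b0 : 0 < `|f z| + 1 by rewrite ltr_wpDl.
have ea : 0 < e / 2%:R / (`|g z| + 1) by rewrite !divr_gt0 // ltr0n.
have eb : 0 < e / 2%:R / (`|f z| + 1) by rewrite !divr_gt0 // ltr0n.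
apply: near_mono2 (cf _ ea) (near_and (cg _ eb) (cg _ ltr01)) => w hf [hg hg1].
have -> : f w * g w - f z * g z = (f w - f z) * g w + (g w - g z) * f z by ring.
have gw : `|g w| <= `|g z| + 1.
  rewrite -[g w](subrK (g z)) addrC; apply: le_trans (ler_normD _ _) _.
  by rewrite lerD2l ltW.
rewrite (splitr e); apply: le_lt_trans (ler_normD _ _) (ltrD _ _).
- rewrite normrM; apply: le_lt_trans (ler_wpM2l (normr_ge0 _) gw) _.
  by rewrite -ltr_pdivlMr.
- rewrite normrM; apply: le_lt_trans (_ : _ <= `|g w - g z| * (`|f z| + 1)) _.
    by rewrite ler_wpM2l // lerDl.
  by rewrite -ltr_pdivlMr.
Qed.

Lemma ccontV z f : f z != 0 -> ccont z f -> ccont z (fun w => (f w)^-1).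
Proof.
move=> fz0 cf e e0.
have a0 : 0 < `|f z| by rewrite normr_gt0.
have a20 : 0 < `|f z| / 2%:R by rewrite divr_gt0 // ltr0n.
have b0 : 0 < e * (`|f z| / 2%:R * `|f z|) by rewrite !mulr_gt0 ?invr_gt0 ?ltr0n.
apply: near_mono2 (cf _ a20) (cf _ b0) => w h1 h2.
have fw : `|f z| / 2%:R < `|f w|.
  have : `|f z| <= `|f w| + `|f w - f z|.
    by rewrite -{1}[f z](subKr (f w)) (le_trans (ler_normB _ _)).
  rewrite {1}(splitr `|f z|) => h; rewrite -(ltrD2r (`|f z| / 2%:R)).
  by apply: le_lt_trans h _; rewrite ltrD2l.
have fw0 : f w != 0 by rewrite -normr_gt0 (lt_trans a20).
have -> : (f w)^-1 - (f z)^-1 = - (f w - f z) / (f w * f z) by field; rewrite fw0 fz0.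
rewrite normrM normrN normfV normrM ltr_pdivrMr ?mulr_gt0 ?normr_gt0 //.
by apply: lt_trans h2 _; rewrite ltr_pM2l // ltr_pM2r.
Qed.

(* Caratheodory's form of differentiability: the calculus rules become
   identities between continuous functions. *)
Lemma cdiffP z f :
  cdiff z f <-> exists g, ccont z g /\ forall w, f w = f z + (w - z) * g w.
Proof.
split=> [[l df]|[g [cg fg]]].
- exists (fun w => if w == z then l else (f w - f z) / (w - z)); split; last first.
    move=> w; case: eqVneq => [->|wz]; first by rewrite subrr mul0r addr0.
    by rewrite [(w - z) * _]mulrC divfK ?subr_eq0 // addrC subrK.
  move=> e e0; have [d [d0 hd]] := df _ e0; exists d; split=> // w wd.
  rewrite eqxx; case: eqVneq => [_|wz]; first by rewrite subrr normr0.
  have := hd (w - z); rewrite subr_eq0 => /(_ wz wd).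
  by rewrite [z + (w - z)]addrC subrK.
- exists (g z) => e e0; have [d [d0 hd]] := cg _ e0; exists d; split=> // h h0 hh.
  rewrite fg addrAC subrr add0r [z + h]addrC addrK mulrAC divff // mul1r.
  by apply: hd; rewrite addrK.
Qed.

Lemma cdiff_cont z f : cdiff z f -> ccont z f.
Proof.
move=> /cdiffP[g [cg fg]].
apply: (@ccont_near _ (fun w => f z + (w - z) * g w)); last exact: nearW.
apply: ccontD; first exact: ccont_const.
apply: ccontM cg; apply: ccontD; [exact: ccont_id|exact: ccont_const].
Qed.

Lemma cdiff_const z c : cdiff z (fun=> c).
Proof.
apply/cdiffP; exists (fun=> 0); split; first exact: ccont_const.
by move=> w; rewrite mulr0 addr0.
Qed.

Lemma cdiff_id z : cdiff z id.
Proof.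
apply/cdiffP; exists (fun=> 1); split; first exact: ccont_const.
by move=> w; rewrite mulr1 addrC subrK.
Qed.

Lemma cdiffD z f g : cdiff z f -> cdiff z g -> cdiff z (fun w => f w + g w).
Proof.
move=> /cdiffP[f1 [cf hf]] /cdiffP[g1 [cg hg]]; apply/cdiffP.
exists (fun w => f1 w + g1 w); split=> [|w]; first exact: ccontD.
by rewrite hf hg; ring.
Qed.

Lemma cdiffM z f g : cdiff z f -> cdiff z g -> cdiff z (fun w => f w * g w).
Proof.
move=> df dg; have cf := cdiff_cont df.
have [f1 [cf1 hf]] := (cdiffP _ _).1 df; have [g1 [cg1 hg]] := (cdiffP _ _).1 dg.
apply/cdiffP; exists (fun w => f1 w * g z + f w * g1 w); split=> [|w].
  by apply: ccontD; apply: ccontM => //; exact: ccont_const.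
by rewrite (hg w) mulrDr {1}(hf w); ring.
Qed.

Lemma cdiffV z f : f z != 0 -> cdiff z f -> cdiff z (fun w => (f w)^-1).
Proof.
move=> fz0 df; have cf := cdiff_cont df; have [g [cg hg]] := (cdiffP _ _).1 df.
have e0 : 0 < `|f z| by rewrite normr_gt0.
(* Caratheodory's form asks for an identity at every [w], including far zeros of [f]. There [h]
   takes its central value, so its increment is 0, and the factor [(f w != 0)%:R] makes the slope 0
   as well. *)
pose h w := if f w == 0 then (f z)^-1 else (f w)^-1.
have fw : nearC z (fun w => f w != 0).
  apply: near_mono (cf _ e0) => w; apply: contraTneq => ->.
  by rewrite sub0r normrN ltxx.
apply: (@cdiff_near _ h); last by apply: near_mono fw => w; rewrite /h => /negbTE ->.
apply/cdiffP; exists (fun w => - g w * h w * (f z)^-1 * (f w != 0)%:R); split=> [|w].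
  have ch : ccont z h.
    apply: ccont_near (ccontV fz0 cf) _.
    by apply: near_mono fw => w; rewrite /h => /negbTE ->.
  apply: (@ccont_near _ (fun w => (-1) * g w * h w * (f z)^-1)).
    by do 3?[apply: ccontM => //]; exact: ccont_const.
  by apply: near_mono fw => w ->; rewrite mulr1 mulN1r.
rewrite /h (negbTE fz0); have [fw0|fw0] := eqVneq (f w) 0.
  by rewrite /= !mulr0 addr0.
have E : (w - z) * g w = f w - f z by rewrite (hg w) [RHS]addrC addKr.
rewrite /= mulr1 !mulrA mulrN E; field; by rewrite fw0 fz0.
Qed.

(* No regularity of [g] beyond continuity is needed at [z]: this replaces the
   removable singularity theorem. *)
Lemma cdiff_chiM z g : ccont z g -> cdiff z (fun w => (w - z) * g w).
Proof.
by move=> cg; apply/cdiffP; exists g; split=> // w; rewrite subrr mul0r add0r.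
Qed.

Lemma ccont_neq0 z f : ccont z f -> f z != 0 -> nearC z (fun w => f w != 0).
Proof.
move=> cf; rewrite -normr_gt0 => /cf; apply: near_mono => w.
by apply: contraTneq => ->; rewrite sub0r normrN ltxx.
Qed.

(** The point [z] is not isolated: [z + d / 2] lies in the punctured disc of radius [d]. There [f]
    and [g] share a value that is closer than half of [|f z - g z|] to both [f z] and [g z]. *)
Lemma ccont_eq_center z f g : ccont z f -> ccont z g ->
  nearC z (fun w => w != z -> f w = g w) -> f z = g z.
Proof.
move=> cf cg fg; apply/eqP; apply: contraT; rewrite -subr_eq0 -normr_gt0 => e0.
have e20 : 0 < `|f z - g z| / 2%:R by rewrite divr_gt0 // ltr0n.
have [d [d0 hd]] := near_and fg (near_and (cf _ e20) (cg _ e20)).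
have d20 : 0 < d / 2%:R by rewrite divr_gt0 // ltr0n.
have [|fgw [h1 h2]] := hd (z + d / 2%:R).
  by rewrite addrC addKr gtr0_norm // ltr_pdivrMr ?ltr0n // mulr_natr mulr2n ltrDl.
rewrite fgw in h1; last by rewrite -subr_eq0 addrC addKr gt_eqF.
have := ltrD h1 h2; rewrite -splitr => /(le_lt_trans (ler_normB _ _)).
by rewrite opprB addrC subrKA -normrN opprB ltxx.
Qed.

Lemma hol_cont z f : hol z f -> ccont z f.
Proof. by move=> /near_center; exact: cdiff_cont. Qed.

Lemma holV z f : f z != 0 -> hol z f -> hol z (fun w => (f w)^-1).
Proof.
move=> fz0 hf; apply: near_mono2 hf (ccont_neq0 (hol_cont hf) fz0) => w df.
by move=> fw0; exact: cdiffV.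
Qed.

End LocalFunctions.

(** * Rings of functions and matrices over them *)

Section FunctionRings.
Variable R : realType.
Local Notation C := R[i].

(** This covers continuity at a point, differentiability at a point, holomorphy near a point and
    holomorphy on a set, so that the closure properties of matrices are proved once for all four. *)
Definition fun_ring (S : (C -> C) -> Prop) : Prop :=
  [/\ forall c, S (fun=> c),
      forall f g, S f -> S g -> S (fun w => f w + g w),
      forall f g, S f -> S g -> S (fun w => f w * g w) &
      forall f g, f =1 g -> S f -> S g].

Lemma fun_ring_ccont z : fun_ring (@ccont R z).
Proof.
split; [exact: ccont_const|exact: ccontD|exact: ccontM|].
by move=> f g fg cf; apply: ccont_near cf (nearW _ fg).
Qed.

Lemma fun_ring_cdiff z : fun_ring (@cdiff R z).
Proof.
split; [exact: cdiff_const|exact: cdiffD|exact: cdiffM|].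
by move=> f g fg df; apply: cdiff_near df (nearW _ fg).
Qed.

Lemma fun_ring_hol z : fun_ring (@hol R z).
Proof.
split=> [c|f g|f g|f g fg hf]; first by apply: nearW => w; exact: cdiff_const.
- by apply: near_mono2 => w; exact: cdiffD.
- by apply: near_mono2 => w; exact: cdiffM.
- by apply: hol_near hf (nearW _ fg).
Qed.

Lemma fun_ring_holo_on (U : C -> Prop) : fun_ring (holo_on U).
Proof.
split=> [c z _|f g hf hg z Uz|f g hf hg z Uz|f g fg hf z Uz].
- exact: cdiff_const.
- exact: cdiffD (hf z Uz) (hg z Uz).
- exact: cdiffM (hf z Uz) (hg z Uz).
- exact: cdiff_near (hf z Uz) (nearW _ fg).
Qed.

Section Closure.
Variable S : (C -> C) -> Prop.
Hypothesis hS : fun_ring S.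

Lemma fr_const c : S (fun=> c). Proof. by case: hS. Qed.

Lemma frD f g : S f -> S g -> S (fun w => f w + g w). Proof. by case: hS => ? + ? ?; exact. Qed.

Lemma frM f g : S f -> S g -> S (fun w => f w * g w). Proof. by case: hS => ? ? + ?; exact. Qed.

Lemma fr_ext f g : f =1 g -> S f -> S g. Proof. by case: hS => ? ? ?; exact. Qed.

Lemma fr_sum (I : Type) (s : seq I) (F : I -> C -> C) :
  (forall i, S (F i)) -> S (fun w => \sum_(i <- s) F i w).
Proof.
move=> hF; elim: s => [|i s IH].
  by apply: fr_ext (fr_const 0) => w; rewrite big_nil.
by apply: fr_ext (frD (hF i) IH) => w; rewrite big_cons.
Qed.

Lemma fr_prod (I : Type) (s : seq I) (F : I -> C -> C) :
  (forall i, S (F i)) -> S (fun w => \prod_(i <- s) F i w).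
Proof.
move=> hF; elim: s => [|i s IH].
  by apply: fr_ext (fr_const 1) => w; rewrite big_nil.
by apply: fr_ext (frM (hF i) IH) => w; rewrite big_cons.
Qed.

Lemma frX f k : S f -> S (fun w => f w ^+ k).
Proof.
move=> hf; elim: k => [|k IH].
  by apply: fr_ext (fr_const 1) => w; rewrite expr0.
by apply: fr_ext (frM hf IH) => w; rewrite exprS.
Qed.

Definition mxfun p q (F : C -> 'M[C]_(p, q)) : Prop :=
  forall i j, S (fun w => F w i j).

Lemma mxfun_ext p q (F G : C -> 'M[C]_(p, q)) : F =1 G -> mxfun F -> mxfun G.
Proof. by move=> FG hF i j; apply: fr_ext (hF i j) => w; rewrite FG. Qed.

Lemma mxfun_const p q (A : 'M[C]_(p, q)) : mxfun (fun=> A).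
Proof. by move=> i j; exact: fr_const. Qed.

Lemma mxfunD p q (F G : C -> 'M[C]_(p, q)) :
  mxfun F -> mxfun G -> mxfun (fun w => F w + G w).
Proof.
by move=> hF hG i j; apply: fr_ext (frD (hF i j) (hG i j)) => w; rewrite mxE.
Qed.

Lemma mxfunZ p q f (F : C -> 'M[C]_(p, q)) :
  S f -> mxfun F -> mxfun (fun w => f w *: F w).
Proof.
by move=> hf hF i j; apply: fr_ext (frM hf (hF i j)) => w; rewrite mxE.
Qed.

Lemma mxfunB p q (F G : C -> 'M[C]_(p, q)) :
  mxfun F -> mxfun G -> mxfun (fun w => F w - G w).
Proof.
move=> hF hG; apply: mxfun_ext (mxfunD hF (mxfunZ (fr_const (-1)) hG)) => w.
by rewrite scaleN1r.
Qed.

Lemma mxfunM p q s (F : C -> 'M[C]_(p, q)) (G : C -> 'M[C]_(q, s)) :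
  mxfun F -> mxfun G -> mxfun (fun w => F w *m G w).
Proof.
move=> hF hG i j; apply: fr_ext (fr_sum _ (fun k => frM (hF i k) (hG k j))) => w.
by rewrite mxE.
Qed.

Lemma mxfunX n (F : C -> 'M[C]_n) k : mxfun F -> mxfun (fun w => F w ^+ k).
Proof.
move=> hF; elim: k => [|k IH].
  by apply: mxfun_ext (mxfun_const 1) => w; rewrite expr0.
by apply: mxfun_ext (mxfunM hF IH) => w; rewrite exprS.
Qed.

Lemma mxfun_sum p q (I : Type) (s : seq I) (F : I -> C -> 'M[C]_(p, q)) :
  (forall i, mxfun (F i)) -> mxfun (fun w => \sum_(i <- s) F i w).
Proof.
move=> hF i j; apply: fr_ext (fr_sum s (fun k => hF k i j)) => w.
by rewrite summxE.
Qed.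

Lemma mxfun_tr p q (F : C -> 'M[C]_(p, q)) : mxfun F -> mxfun (fun w => (F w)^T).
Proof. by move=> hF i j; apply: fr_ext (hF j i) => w; rewrite mxE. Qed.

Lemma mxfun_col_mx p q s (F : C -> 'M[C]_(p, s)) (G : C -> 'M[C]_(q, s)) :
  mxfun F -> mxfun G -> mxfun (fun w => col_mx (F w) (G w)).
Proof.
move=> hF hG i j; case: (split_ordP i) => k ->.
  by apply: fr_ext (hF k j) => w; rewrite col_mxEu.
by apply: fr_ext (hG k j) => w; rewrite col_mxEd.
Qed.

Lemma fr_det n (F : C -> 'M[C]_n) : mxfun F -> S (fun w => \det (F w)).
Proof.
move=> hF; apply: fr_sum => s; apply: frM; first exact: fr_const.
by apply: fr_prod => i; exact: hF.
Qed.

Lemma mxfun_adj n (F : C -> 'M[C]_n) : mxfun F -> mxfun (fun w => \adj (F w)).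
Proof.
move=> hF i j; apply: (@fr_ext (fun w => cofactor (F w) j i)); first by move=> w; rewrite mxE.
apply: frM; first exact: fr_const.
by apply: fr_det => k l; apply: fr_ext (hF (lift j k) (lift i l)) => w; rewrite !mxE.
Qed.

End Closure.

(** Unlike [invmx], this has no case distinction on invertibility: the adjugate is polynomial in the
    entries, and holomorphy follows from the closure properties and [holV]. *)
Definition mxinv n (A : 'M[C]_n) : 'M[C]_n := (\det A)^-1 *: \adj A.

Lemma mulmxinv n (A : 'M[C]_n) : \det A != 0 -> A *m mxinv A = 1%:M.
Proof.
by move=> h; rewrite -scalemxAr mul_mx_adj scale_scalar_mx mulVf.
Qed.

Lemma mxinvmul n (A : 'M[C]_n) : \det A != 0 -> mxinv A *m A = 1%:M.
Proof. by move=> /mulmxinv /mulmx1C. Qed.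

Lemma mxfun_inv z n (F : C -> 'M[C]_n) : \det (F z) != 0 ->
  mxfun (hol z) F -> mxfun (hol z) (fun w => mxinv (F w)).
Proof.
move=> dF hF; apply: (mxfunZ (fun_ring_hol z)).
  by apply: holV => //; exact: (fr_det (fun_ring_hol z)).
exact: (mxfun_adj (fun_ring_hol z)).
Qed.

(** * Holomorphic matrices near a point and on an open set *)

Lemma mxfun_cont z p q (F : C -> 'M[C]_(p, q)) :
  mxfun (hol z) F -> mxfun (ccont z) F.
Proof. by move=> hF i j; exact: hol_cont. Qed.

Lemma mxfun_neq0 z n (F : C -> 'M[C]_n) :
  mxfun (ccont z) F -> \det (F z) != 0 -> nearC z (fun w => \det (F w) != 0).
Proof. by move=> hF; apply: ccont_neq0; exact: (fr_det (fun_ring_ccont z)). Qed.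

Lemma mx_eq_center z p q (F G : C -> 'M[C]_(p, q)) :
  mxfun (ccont z) F -> mxfun (ccont z) G ->
  nearC z (fun w => w != z -> F w = G w) -> F z = G z.
Proof.
move=> hF hG FG; apply/matrixP => i j; apply: ccont_eq_center (hF i j) (hG i j) _.
by apply: near_mono FG => w h /h ->.
Qed.

(** Identities obtained by dividing by [Delta] hold only off the center; continuity restores them
    there. *)
Lemma near_fill z p q (F G : C -> 'M[C]_(p, q)) :
  mxfun (ccont z) F -> mxfun (ccont z) G ->
  nearC z (fun w => w != z -> F w = G w) -> nearC z (fun w => F w = G w).
Proof.
move=> hF hG FG; have E := mx_eq_center hF hG FG.
by apply: near_mono FG => w h; have [->|/h] := eqVneq w z.
Qed.

Lemma mholo_nearP z p q (F : C -> 'M[C]_(p, q)) :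
  mholo_near z F <-> mxfun (hol z) F.
Proof.
split=> [[U [oU [Uz hF]]] i j|hF].
  by have [d [d0 hd]] := oU _ Uz; exists d; split=> // w /hd; exact: hF.
have [d [d0 hd]] : nearC z (fun w => forall i j, cdiff w (fun v => F v i j)).
  by do 2![apply: near_forall => ?]; exact: hF.
exists (fun w => `|w - z| < d); split; last first.
  split=> [|i j w /hd]; first by rewrite subrr normr0.
  exact.
move=> w wd; exists (d - `|w - z|); split=> [|v vw]; first by rewrite subr_gt0.
rewrite -(subrKA w); apply: le_lt_trans (ler_normD _ _) _.
by rewrite -ltrBrDr.
Qed.

Lemma mholo_on_hol (U : C -> Prop) z p q (F : C -> 'M[C]_(p, q)) :
  openC U -> U z -> mholo_on U F -> mxfun (hol z) F.
Proof. by move=> oU Uz hF; apply/mholo_nearP; exists U. Qed.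

(** This turns a quotient by powers of [w - z] into a function holomorphic on all of [U].
    Differentiability is local: at [z] it is inherited from [G], elsewhere from [F]. *)
Lemma mholo_on_patch (U : C -> Prop) z p q (F G : C -> 'M[C]_(p, q)) :
  mholo_on (fun w => U w /\ w != z) F -> mxfun (hol z) G ->
  nearC z (fun w => w != z -> F w = G w) ->
  mholo_on U (fun w => if w == z then G z else F w).
Proof.
move=> hF hG FG i j w Uw; have [->|wz] := eqVneq w z.
  apply: cdiff_near (near_center (hG i j)) _.
  by apply: near_mono FG => v h; case: eqVneq => [->|/h ->].
apply: cdiff_near (hF i j w (conj Uw wz)) _.
by apply: near_mono (near_neq wz) => v /negbTE ->.
Qed.

End FunctionRings.

(** * Diagonal matrices of powers *)

Section DiagonalMatrices.
Variable R : realType.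
Local Notation C := R[i].
Implicit Types (z w : C) (m nu : nat -> nat).

Lemma mxfun_Delta (S : (C -> C) -> Prop) r z m :
  fun_ring S -> S id -> mxfun S (Delta r z m).
Proof.
move=> hS Sid i j.
pose f w : C := (w - z) ^+ m i * (i == j)%:R.
apply: (@fr_ext _ _ hS f); first by move=> w; rewrite /f !mxE mulr_natr.
apply: (frM hS); last exact: fr_const.
by apply: (frX hS); apply: (frD hS) => //; exact: (fr_const hS).
Qed.

Lemma mxfun_Delta_inv (U : C -> Prop) r z m :
  mxfun (holo_on (fun w => U w /\ w != z)) (Delta_inv r z m).
Proof.
have hS := fun_ring_holo_on (fun w => U w /\ w != z).
move=> i j; pose f w : C := ((w - z)^-1) ^+ m i * (i == j)%:R.
apply: (@fr_ext _ _ hS f); first by move=> w; rewrite /f !mxE mulr_natr.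
apply: (frM hS); last exact: (fr_const hS).
apply: (frX hS) => w [_ wz]; apply: cdiffV; first by rewrite subr_eq0.
by apply: cdiffD; [exact: cdiff_id|exact: cdiff_const].
Qed.

Lemma mul_Delta_inv r z m w : w != z -> Delta r z m w *m Delta_inv r z m w = 1%:M.
Proof.
move=> wz; rewrite mulmx_diag; apply/matrixP => i j; rewrite !mxE -exprMn.
by rewrite divff ?subr_eq0 // expr1n.
Qed.

Lemma mul_invDelta r z m w : w != z -> Delta_inv r z m w *m Delta r z m w = 1%:M.
Proof. by move=> /(mul_Delta_inv r m) /mulmx1C. Qed.

Lemma Delta_center r z m : (forall i, (i < r)%N -> (0 < m i)%N) -> Delta r z m z = 0.
Proof.
move=> m0; apply/matrixP => i j; rewrite !mxE subrr.
by rewrite expr0n gtn_eqF ?m0 // mul0rn.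
Qed.

Lemma Delta_block r s z m w : (forall i, (r <= i < r + s)%N -> m i = 0%N) ->
  Delta (r + s) z m w = block_mx (Delta r z m w) 0 0 1%:M.
Proof.
move=> m0; apply/matrixP => i j.
case: (split_ordP i) => k ->; case: (split_ordP j) => l ->.
- by rewrite block_mxEul !mxE eq_lshift.
- by rewrite block_mxEur !mxE eq_lrshift.
- by rewrite block_mxEdl !mxE eq_rlshift.
- rewrite block_mxEdr !mxE eq_rshift m0 ?expr0 //=.
  by rewrite leq_addr ltn_add2l ltn_ord.
Qed.

Lemma eq_Delta r z m nu w : (forall i : 'I_r, m i = nu i) ->
  Delta r z m w = Delta r z nu w.
Proof. by move=> h; apply/matrixP => i j; rewrite !mxE h. Qed.

Lemma Delta_tr r z m w : (Delta r z m w)^T = Delta r z m w.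
Proof. exact: tr_diag_mx. Qed.

(** * Uniqueness of the local Smith form *)

Lemma det_Delta r z m w : \det (Delta r z m w) = (w - z) ^+ (\sum_(i < r) m i)%N.
Proof. by rewrite det_diag -prodrXr; apply: eq_bigr => i _; rewrite mxE. Qed.

(** By pigeonhole, every term of the Leibniz expansion has a factor in the zero block: a permutation
    cannot map the [n - k] indices [i >= k] into the [n - k - 1] indices above [k]. *)
Lemma det_zero_block n (B : 'M[C]_n) (k : 'I_n) :
  (forall i j : 'I_n, (k <= i)%N -> (j <= k)%N -> B i j = 0) -> \det B = 0.
Proof.
move=> B0; rewrite /determinant big1 // => /= s _.
suff [i ki sik] : exists2 i : 'I_n, (k <= i)%N & (s i <= k)%N.
  by rewrite (bigD1 i) //= B0 // mul0r mulr0.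
apply/exists_inP; apply: contraT => /exists_inPn h.
have : ((fun i => s i) @: [set i : 'I_n | k <= i] \subset [set i : 'I_n | k < i])%N.
  apply/subsetP => _ /imsetP[i + ->]; rewrite !inE => ki.
  by rewrite ltnNge; exact: h.
move=> /subset_leq_card; rewrite card_imset; last exact: perm_inj.
rewrite leqNgt => /negP[]; apply/proper_card/properP; split.
  by apply/subsetP => i; rewrite !inE => /ltnW.
by exists k; rewrite inE ?ltnn.
Qed.

(** If [nu k < m k], then [nu i < m j] for all [i >= k >= j] by monotonicity. Comparing entries
    gives [B i j = (w - z)^(m j - nu i) A i j] off [z], so [B z] has the zero block of
    [det_zero_block], against [det (B z) != 0]. *)
Lemma smith_le n z m nu (A B : C -> 'M[C]_n) :
  mxfun (ccont z) A -> mxfun (ccont z) B -> \det (B z) != 0 ->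
  (forall i j, (i <= j < n)%N -> (m j <= m i)%N) ->
  (forall i j, (i <= j < n)%N -> (nu j <= nu i)%N) ->
  nearC z (fun w => A w *m Delta n z m w = Delta n z nu w *m B w) ->
  forall k : 'I_n, (m k <= nu k)%N.
Proof.
move=> cA cB dB md nd AB k; rewrite leqNgt; apply: contra dB => lt_nu_m.
apply/eqP/(det_zero_block (k := k)) => i j ki jk.
have lt_ij : (nu i < m j)%N.
  apply: leq_ltn_trans (_ : nu k < _)%N; first by apply: nd; rewrite ki ltn_ord.
  by apply: leq_trans lt_nu_m _; apply: md; rewrite jk ltn_ord.
have hS := fun_ring_ccont z.
have cg : ccont z (fun w => (w - z) ^+ (m j - nu i) * A w i j).
  apply: (frM hS) => //; apply: (frX hS).
  by apply: (frD hS); [exact: ccont_id|exact: ccont_const].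
rewrite (ccont_eq_center (cB i j) cg).
  by rewrite subrr expr0n subn_eq0 leqNgt lt_ij mul0r.
apply: near_mono AB => w /matrixP/(_ i j) E wz; move: E.
rewrite mul_mx_diag mul_diag_mx !mxE -(subnKC (ltnW lt_ij)) exprD mulrCA.
have c0 : (w - z) ^+ nu i != 0 by rewrite expf_neq0 // subr_eq0.
by move=> /(mulfI c0) <-; rewrite addKn mulrC.
Qed.

(** Transposing the relation exchanges [m] and [nu], so both inequalities come from [smith_le]. *)
Lemma smith_uniq n z m nu (A B : C -> 'M[C]_n) :
  mxfun (ccont z) A -> mxfun (ccont z) B ->
  \det (A z) != 0 -> \det (B z) != 0 ->
  (forall i j, (i <= j < n)%N -> (m j <= m i)%N) ->
  (forall i j, (i <= j < n)%N -> (nu j <= nu i)%N) ->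
  nearC z (fun w => A w *m Delta n z m w = Delta n z nu w *m B w) ->
  forall k : 'I_n, m k = nu k.
Proof.
move=> cA cB dA dB md nd AB k; apply/eqP; rewrite eqn_leq.
rewrite (smith_le cA cB dB md nd AB) /=.
have hS := fun_ring_ccont z.
apply: (smith_le (mxfun_tr hS cB) (mxfun_tr hS cA) _ nd md); first by rewrite det_tr.
by apply: near_mono AB => w /(congr1 trmx); rewrite !trmx_mul !Delta_tr => <-.
Qed.

Lemma unimodular_det n z (M : C -> 'M[C]_n) : unimodular z M -> \det (M z) != 0.
Proof.
move=> [_ [N [_ /near_center[MN _]]]].
by move/mulmx1_unit: MN => [+ _]; rewrite unitmxE unitfE.
Qed.

(** Since the sums agree, the powers of [w - z] in the determinants of [UL T UR] and [P T] cancel.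
    This leaves [det P = det UL * det UR * det Q] off [z], hence at [z], and [Q z] is invertible;
    then [smith_uniq] applies. *)
Lemma factor_multiplicities n z m nu (T P Q : C -> 'M[C]_n) :
  partial_multiplicities z T m ->
  (forall i j, (i <= j < n)%N -> (nu j <= nu i)%N) ->
  (\sum_(i < n) nu i = \sum_(i < n) m i)%N ->
  mxfun (ccont z) P -> mxfun (ccont z) Q -> \det (P z) != 0 ->
  nearC z (fun w => P w *m T w = Delta n z nu w *m Q w) ->
  \det (Q z) != 0 /\ forall i : 'I_n, nu i = m i.
Proof.
move=> [md [UL [UR [uL [uR hT]]]]] nd sum_eq cP cQ dP PT.
have hS := fun_ring_ccont z.
have [[/mholo_nearP/mxfun_cont cUL [N [/mholo_nearP/mxfun_cont cN UN]]] dUL] :=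
  (uL, unimodular_det uL).
have [[/mholo_nearP/mxfun_cont cUR _] dUR] := (uR, unimodular_det uR).
have dN : \det (N z) != 0.
  by have [/mulmx1_unit[_ +] _] := near_center UN; rewrite unitmxE unitfE.
have detE : \det (P z) = \det (UL z) * \det (UR z) * \det (Q z).
  have cR : ccont z (fun w => \det (UL w) * \det (UR w) * \det (Q w)).
    by do 2?[apply: (frM hS)]; exact: (fr_det hS).
  apply: (ccont_eq_center (fr_det hS cP) cR).
  apply: near_mono2 hT PT => w /(congr1 determinant) + /(congr1 determinant) + wz.
  rewrite !det_mulmx -/(Delta n z m w) !det_Delta sum_eq.
  set c := _ ^+ _ => E1 E2; have c0 : c != 0 by rewrite expf_neq0 // subr_eq0.
  apply: (mulfI c0); rewrite -{1}E1.
  transitivity (\det (UL w) * \det (UR w) * (\det (P w) * \det (T w))); first by ring.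
  by rewrite E2; ring.
have dQ : \det (Q z) != 0.
  by move: dP; rewrite detE mulf_eq0 negb_or => /andP[].
split=> //; move=> i; apply/esym; move: i.
(* As [N] inverts [UL], one has [P N Delta_m = P T UR = Delta_nu Q UR]. *)
apply: (@smith_uniq n z m nu (fun w => P w *m N w) (fun w => Q w *m UR w)) => //.
- exact: (mxfunM hS).
- exact: (mxfunM hS).
- by rewrite det_mulmx mulf_neq0.
- by rewrite det_mulmx mulf_neq0.
apply: near_mono2 (near_and UN hT) PT => w [[_ NU] E1] E2.
by rewrite mulmxA -E2 /Delta -E1 -!mulmxA (mulmxA (N w)) NU mul1mx.
Qed.

(** At [z] the Smith form is diagonal with entries [0 ^+ m i], that is 1 where [m i = 0] and 0
    elsewhere. Its rank, which is that of [T z], counts the zero multiplicities. *)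
Lemma multiplicities_rank r s z m (T : C -> 'M[C]_(r + s)) :
  partial_multiplicities z T m -> \rank (T z) = s ->
  (forall i, (i < r)%N -> (0 < m i)%N) /\
  (forall i, (r <= i < r + s)%N -> m i = 0%N).
Proof.
move=> [md [UL [UR [uL [uR hT]]]]] rT.
have dUL := unimodular_det uL; have dUR := unimodular_det uR.
(* The first index with multiplicity 0, or [r + s] if there is none; by monotonicity [m] vanishes
   exactly from [t] on. *)
pose t := find (fun i => m i == 0%N) (iota 0 (r + s)).
have tle : (t <= r + s)%N by rewrite -[leqRHS](size_iota 0) find_size.
have mt i : (i < r + s)%N -> (m i == 0%N) = (t <= i)%N.
  move=> irs; case: leqP => [ti|it].
    have trs := leq_ltn_trans ti irs.
    have : has (fun i => m i == 0%N) (iota 0 (r + s)) by rewrite has_find size_iota.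
    move=> /(nth_find 0%N); rewrite nth_iota // add0n => /eqP mt0.
    by rewrite -leqn0 -mt0; apply: md; rewrite ti.
  by have /= := before_find 0%N it; rewrite nth_iota.
have DE : Delta (r + s) z m z = copid_mx t.
  apply/matrixP => i j; rewrite !mxE subrr expr0n mt //.
  by rewrite -(inj_eq val_inj); case: leqP; case: eqP => //= _ _;
     rewrite ?subr0 ?subrr ?mulr0n ?mulr1n.
have rk : \rank (Delta (r + s) z m z) = s.
  rewrite /Delta -(near_center hT) mxrankMfree ?row_free_unit ?unitmxE ?unitfE //.
  by rewrite eqmxMfull // row_full_unit unitmxE unitfE.
have tr : t = r.
  by apply: (@addnI s); rewrite -{1}rk DE rank_copid_mx // subnK // addnC.
split=> i.
  by move=> ir; rewrite lt0n mt ?tr -?ltnNge // ltn_addr.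
by move=> /andP[ri irs]; apply/eqP; rewrite mt ?tr.
Qed.

(** * Divisibility by [Delta] for canonical matrices *)

Lemma row_completion r s (V : 'M[C]_(r, r + s)) : \rank V = r ->
  exists E : 'M[C]_(s, r + s), \det (col_mx V E) != 0.
Proof.
move=> rV; exists (dsubmx (row_ebase V)).
have -> : col_mx V (dsubmx (row_ebase V)) =
    block_mx (col_ebase V) 0 0 1%:M *m row_ebase V.
  rewrite -[in RHS](vsubmxK (row_ebase V)) mul_block_col !mul0mx mul1mx add0r addr0.
  congr col_mx; rewrite -{1}(mulmx_ebase V) rV -{1}(vsubmxK (row_ebase V)).
  have -> : pid_mx r = row_mx 1%:M 0 :> 'M[C]_(r, r + s).
    apply/matrixP => i j; case: (split_ordP j) => k ->.
      by rewrite row_mxEl !mxE ltn_ord andbT.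
    by rewrite row_mxEr !mxE ltn_ord andbT /= ltn_eqF // ltn_addr.
  by rewrite -mulmxA mul_row_col mul1mx mul0mx addr0.
rewrite det_mulmx det_ublock det1 mulr1 mulf_neq0 //.
  by have := col_ebase_unit V; rewrite unitmxE unitfE.
by have := row_ebase_unit V; rewrite unitmxE unitfE.
Qed.

(** The orders [nu] of the rows of [V] are only known to have the same sum as [m];
    [factor_multiplicities], applied to the completed matrices, shows that they equal [m]. *)
Lemma left_canonical_factor (Om : C -> Prop) z r s m
    (T : C -> 'M[C]_(r + s)) (V : C -> 'M[C]_(r, r + s)) :
  openC Om -> Om z -> mholo_on Om T ->
  partial_multiplicities z T m -> \rank (T z) = s ->
  left_canonical Om z T m V ->
  exists (W : C -> 'M[C]_(r, r + s)) (E : 'M[C]_(s, r + s)),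
    [/\ mxfun (hol z) W,
        nearC z (fun w => V w *m T w = Delta r z m w *m W w),
        \det (col_mx (V z) E) != 0 & \det (col_mx (W z) (E *m T z)) != 0].
Proof.
move=> oOm Omz /(mholo_on_hol oOm Omz)/mxfun_cont cT pm rT.
move=> [/(mholo_on_hol oOm Omz)/mxfun_cont cV [nu [hV [rV [snu nd]]]]].
have [_ m0] := multiplicities_rank pm rT.
have [E dP] := row_completion rV.
have [h hh] : exists h : 'I_r -> C -> 'rV[C]_(r + s), forall i : 'I_r,
    mxfun (hol z) (h i) /\
    nearC z (fun w => row i (V w) *m T w = (w - z) ^+ nu i *: h i w).
  apply: (fin_all_exists (P := fun (i : 'I_r) (h : C -> 'rV[C]_(r + s)) =>
    mxfun (hol z) h /\
    nearC z (fun w => row i (V w) *m T w = (w - z) ^+ nu i *: h w))) => i.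
  have [_ [_ [_ [h [/mholo_nearP hh [_ E']]]]]] := hV i.
  by exists h.
pose W w : 'M[C]_(r, r + s) := \matrix_i h i w.
have hW : mxfun (hol z) W.
  move=> i j; apply: fr_ext ((hh i).1 0 j) => [|w]; first exact: fun_ring_hol.
  by rewrite mxE.
have VT : nearC z (fun w => V w *m T w = Delta r z nu w *m W w).
  apply: near_mono (near_forall (fun i => (hh i).2)) => w hw.
  apply/row_matrixP => i; rewrite row_mul hw; apply/rowP => j.
  by rewrite [RHS]mxE mul_diag_mx !mxE.
(* Padding by zeros accounts for the constant rows [E], and the sums still agree because [m]
   vanishes from [r] on. *)
pose nu' i := if (i < r)%N then nu i else 0%N.
have nu'0 i : (r <= i < r + s)%N -> nu' i = 0%N by rewrite /nu' [(i < r)%N]ltnNge => /andP[->].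
have nuE (i : 'I_r) : nu i = nu' i by rewrite /nu' ltn_ord.
have hS := fun_ring_ccont z; have cW := mxfun_cont hW.
have [dQ numE] : \det (col_mx (W z) (E *m T z)) != 0 /\
    forall i : 'I_(r + s), nu' i = m i.
  apply: (factor_multiplicities (P := fun w => col_mx (V w) E)
                                (Q := fun w => col_mx (W w) (E *m T w)) pm) => //.
  - move=> i j /andP[ij jrs]; rewrite /nu'; case: (ltnP j r) => // jr.
    by rewrite (leq_ltn_trans ij jr); apply: nd; rewrite ij.
  - rewrite !big_split_ord /=; congr (_ + _)%N.
      by rewrite -snu; apply: eq_bigr => i _; rewrite nuE.
    by apply: eq_bigr => i _; rewrite nu'0 ?m0 // leq_addr ltn_add2l ltn_ord.
  - by apply: mxfun_col_mx => //; exact: mxfun_const.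
  - by apply: mxfun_col_mx => //; apply: (mxfunM hS) => //; exact: mxfun_const.
  apply: near_mono VT => w VTw; rewrite Delta_block // mul_block_col mul_col_mx.
  by rewrite !mul0mx mul1mx addr0 add0r VTw (eq_Delta _ _ nuE).
exists W, E; split=> //; apply: near_mono VT => w ->.
by congr (_ *m _); apply: eq_Delta => i; rewrite nuE (numE (lshift s i)).
Qed.

(** The transpose of [Y] is left canonical for the transpose of [T], which has the same
    multiplicities, with [UL] and [UR] transposed and exchanged. *)
Lemma right_canonical_factor (Om : C -> Prop) z r s m
    (T : C -> 'M[C]_(r + s)) (Y : C -> 'M[C]_(r + s, r)) :
  openC Om -> Om z -> mholo_on Om T ->
  partial_multiplicities z T m -> \rank (T z) = s ->
  right_canonical Om z T m Y ->
  exists L : C -> 'M[C]_(r + s, r),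
    mxfun (hol z) L /\ nearC z (fun w => T w *m Y w = L w *m Delta r z m w).
Proof.
have mtr p q (U : C -> Prop) (F : C -> 'M[C]_(p, q)) :
    mholo_on U F -> mholo_on U (fun w => (F w)^T).
  exact: (mxfun_tr (fun_ring_holo_on U)).
have htr p q (F : C -> 'M[C]_(p, q)) :
    mholo_near z F -> mholo_near z (fun w => (F w)^T).
  by move=> /mholo_nearP /(mxfun_tr (fun_ring_hol z)) ?; apply/mholo_nearP.
have utr n (M : C -> 'M[C]_n) : unimodular z M -> unimodular z (fun w => (M w)^T).
  move=> [/htr hM [N [/htr hN MN]]]; split=> //; exists (fun w => (N w)^T); split=> //.
  by apply: near_mono MN => w [MN NM]; rewrite -!trmx_mul NM MN trmx1.
move=> oOm Omz hT [md [UL [UR [/utr uL [/utr uR D]]]]] rT.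
move=> [hY [nu [hnu [rY [snu nd]]]]].
have [||||||W [E [hW YT _ _]]] := @left_canonical_factor Om z r s m
  (fun w => (T w)^T) (fun w => (Y w)^T) => //.
- exact: mtr.
- split=> //; exists (fun w => (UR w)^T), (fun w => (UL w)^T); split=> //; split=> //.
  by apply: near_mono D => w /(congr1 trmx); rewrite !trmx_mul tr_diag_mx mulmxA.
- by rewrite mxrank_tr.
- split; first exact: mtr.
  exists nu; split=> [i|]; last by rewrite mxrank_tr.
  have [hy [y0 [Ty0 [h [hh [h0 hE]]]]]] := hnu i.
  split; first by move=> k j w Omw; apply: cdiff_near (hy j k w Omw) _;
    apply: nearW => v; rewrite !mxE.
  rewrite -tr_col -trmx_mul Ty0 trmx0; split; last split=> //.
    by apply: contra y0 => /eqP/(congr1 trmx); rewrite trmxK trmx0 => ->.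
  exists (fun w => (h w)^T); split; first exact: htr.
  split; first by apply: contra h0 => /eqP/(congr1 trmx); rewrite trmxK trmx0 => ->.
  by apply: near_mono hE => w Ew; rewrite -tr_col -trmx_mul Ew linearZ.
exists (fun w => (W w)^T); split; first exact: (mxfun_tr (fun_ring_hol z)).
apply: near_mono YT => w /(congr1 trmx).
by rewrite !trmx_mul !trmxK Delta_tr.
Qed.

(* Each entry of [N] is [w - z] times a function [g] continuous at [z], so one
   factor [w - z] is spent to make the product of [k.+1] of the [g]'s
   differentiable at [z]. *)
Lemma pow_center0 n z (N : C -> 'M[C]_n) k : mxfun (hol z) N -> N z = 0 ->
  exists B : C -> 'M[C]_n, mxfun (hol z) B /\
    forall w, N w ^+ k.+1 = (w - z) ^+ k *: B w.
Proof.
move=> hN Nz0.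
have [g hg] : exists g : 'I_n -> 'I_n -> C -> C, forall i j,
    ccont z (g i j) /\ forall w, N w i j = (w - z) * g i j w.
  pose gP i j (g : C -> C) := ccont z g /\ forall w, N w i j = (w - z) * g w.
  apply: (fin_all_exists (P := fun i g => forall j, gP i j (g j))) => i.
  apply: (fin_all_exists (P := gP i)) => j.
  have /cdiffP[f [cf hf]] := near_center (hN i j).
  by exists f; split=> // w; rewrite hf Nz0 mxE add0r.
pose G w : 'M[C]_n := \matrix_(i, j) g i j w.
have NG w : N w = (w - z) *: G w by apply/matrixP => i j; rewrite !mxE (hg i j).2.
have powG w l : N w ^+ l = (w - z) ^+ l *: G w ^+ l.
  elim: l => [|l IH]; first by rewrite !expr0 scale1r.
  rewrite !exprS IH NG; apply: etrans (_ : ((w - z) *: G w) *m _ = _) _ => //.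
  by rewrite -scalemxAl -scalemxAr scalerA.
exists (fun w => (w - z) *: G w ^+ k.+1); split=> [i j|w]; last first.
  by rewrite powG scalerA -exprSr.
apply: near_mono (near_forall (fun i => near_forall (fun j => hN i j))) => w dN.
have [->|wz] := eqVneq w z.
  have cG : mxfun (ccont z) (fun v => G v ^+ k.+1).
    apply: (mxfunX (fun_ring_ccont z)) => a b.
    apply: (fr_ext (fun_ring_ccont z)) (hg a b).1 => v.
    by rewrite mxE.
  by apply: cdiff_near (cdiff_chiM (cG i j)) _; apply: nearW => v; rewrite [RHS]mxE.
have hS := fun_ring_cdiff w.
have dinv : cdiff w (fun v => (v - z)^-1).
  apply: cdiffV; first by rewrite subr_eq0.
  by apply: cdiffD; [exact: cdiff_id|exact: cdiff_const].
(* Away from [z], differentiability is read off from [N]: there the witness is [N ^+ k.+1] divided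
   by [(v - z) ^+ k]. *)
have dB := mxfunZ hS (frX hS k dinv) (mxfunX hS k.+1 dN).
apply: cdiff_near (dB i j) _; apply: near_mono (near_neq wz) => v vz.
rewrite powG scalerA exprVn exprSr mulrA mulVf ?mul1r //.
by rewrite expf_neq0 // subr_eq0.
Qed.

End DiagonalMatrices.

(** * Biorthogonal right canonical matrices *)

Section Biorthogonality.
Variable R : realType.
Local Notation C := R[i].
Variables (Om : C -> Prop) (z0 : C) (r s : nat) (m : nat -> nat).
Variables (T : C -> 'M[C]_(r + s)) (V W : C -> 'M[C]_(r, r + s)).
Variable E : 'M[C]_(s, r + s).
Hypotheses (openOm : openC Om) (Om_z0 : Om z0) (holT : mholo_on Om T).
Hypotheses (pmT : partial_multiplicities z0 T m) (rankT : \rank (T z0) = s).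
Hypotheses (holV : mholo_on Om V) (holW : mxfun (hol z0) W).
Hypothesis VT : nearC z0 (fun w => V w *m T w = Delta r z0 m w *m W w).
Hypothesis detP : \det (col_mx (V z0) E) != 0.
Hypothesis detQ : \det (col_mx (W z0) (E *m T z0)) != 0.

Let hS : fun_ring (hol z0). Proof. exact: fun_ring_hol. Qed.

Local Notation D := (Delta r z0 m).
Local Notation Dinv := (Delta_inv r z0 m).
Local Notation P w := (col_mx (V w) E).
Local Notation Q w := (col_mx (W w) (E *m T w)).
Local Notation I0 := (col_mx 1%:M 0 : 'M[C]_(r + s, r)).

Let m_gt0 i : (i < r)%N -> (0 < m i)%N.
Proof. exact: (multiplicities_rank pmT rankT).1. Qed.

Let D0 : D z0 = 0. Proof. exact: Delta_center. Qed.

Let hol_id : hol z0 id.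
Proof. by apply: nearW => w; exact: cdiff_id. Qed.

Let hT : mxfun (hol z0) T. Proof. exact: mholo_on_hol holT. Qed.

Let hV : mxfun (hol z0) V. Proof. exact: mholo_on_hol holV. Qed.

Let hD : mxfun (hol z0) D. Proof. exact: mxfun_Delta hS hol_id. Qed.

Let hP : mxfun (hol z0) (fun w => P w).
Proof. by apply: mxfun_col_mx => //; exact: (mxfun_const hS). Qed.

Let hQ : mxfun (hol z0) (fun w => Q w).
Proof.
by apply: mxfun_col_mx => //; apply: (mxfunM hS) => //; exact: (mxfun_const hS).
Qed.

Let near_detP : nearC z0 (fun w => \det (P w) != 0).
Proof. exact: (mxfun_neq0 (mxfun_cont hP)). Qed.

Let near_detQ : nearC z0 (fun w => \det (Q w) != 0).
Proof. exact: (mxfun_neq0 (mxfun_cont hQ)). Qed.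

Let PT : nearC z0 (fun w => P w *m T w = block_mx (D w) 0 0 1%:M *m Q w).
Proof.
apply: near_mono VT => w VTw.
by rewrite mul_block_col mul_col_mx !mul0mx mul1mx addr0 add0r VTw.
Qed.

(** The upper block [W Y = 1 + K1 Delta] is biorthogonality, as [W] is [Delta^-1 V T]. It gives
    [V T Y = (1 + Delta K1) Delta], and with the lower block [E T Y = K2 Delta] it makes [T Y]
    divisible by [Delta] on the right. *)
Definition biorthogonal_form (Y : C -> 'M[C]_(r + s, r)) : Prop :=
  exists K : C -> 'M[C]_(r + s, r), mxfun (hol z0) K /\
    nearC z0 (fun w => Q w *m Y w = I0 + K w *m D w).

Lemma invVT_W w : w != z0 -> V w *m T w = D w *m W w -> Dinv w *m V w *m T w = W w.
Proof. by move=> wz VTw; rewrite -mulmxA VTw mulmxA mul_invDelta // mul1mx. Qed.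

Lemma right_canonical_of_form Y : mholo_on Om Y -> biorthogonal_form Y ->
  right_canonical Om z0 T m Y.
Proof.
move=> hY [K [hK QY]].
(* From [P T = diag(Delta, 1) Q] and [diag(Delta, 1) I0 = I0 Delta] one gets [P T Y = A Delta],
   hence [T Y = L Delta]. *)
pose A w := I0 + block_mx (D w) 0 0 1%:M *m K w.
pose L w := mxinv (P w) *m A w.
have hBD : mxfun (hol z0) (fun w => block_mx (D w) 0 0 1%:M : 'M[C]_(r + s)).
  apply: (@mxfun_ext _ _ hS _ _ (Delta (r + s) z0 m)); last exact: mxfun_Delta hS hol_id.
  by move=> w; apply: Delta_block; exact: (multiplicities_rank pmT rankT).2.
have hL : mxfun (hol z0) L.
  apply: (mxfunM hS); first exact: mxfun_inv.
  by apply: (mxfunD hS); [exact: (mxfun_const hS)|exact: (mxfunM hS)].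
have TY : nearC z0 (fun w => T w *m Y w = L w *m D w).
  apply: near_mono2 (near_and PT near_detP) QY => w [PTw dP] QYw.
  rewrite -[T w]mul1mx -(mxinvmul dP) /L -!mulmxA; congr (_ *m _).
  rewrite mulmxA PTw -mulmxA QYw /A mulmxDr mulmxDl mulmxA; congr (_ + _).
  by rewrite mul_block_col mul_col_mx !mul0mx !mulmx0 !mulmx1 mul1mx !addr0.
(* Since [Delta] vanishes at [z0], the upper block of [A z0] is the identity. So no column of [L z0]
   is zero, and the orders are exactly the [m i]. *)
have LE : usubmx (P z0 *m L z0) = 1%:M.
  rewrite /L mulmxA mulmxinv // mul1mx /A D0.
  rewrite -[K z0]vsubmxK mul_block_col !mul0mx !add0r add_col_mx col_mxKu.
  by rewrite addr0.
have QY0 : usubmx (Q z0 *m Y z0) = 1%:M.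
  by rewrite (near_center QY) D0 mulmx0 addr0 col_mxKu.
have col_neq0 (A' : 'M[C]_(r + s)) (B' : 'M[C]_(r + s, r)) i :
    usubmx (A' *m B') = 1%:M -> col i B' != 0.
  move=> h; apply/eqP => B0.
  have {}B0 l : B' l i = 0 by move/colP/(_ l): B0; rewrite !mxE.
  move/matrixP/(_ i i)/eqP: h; rewrite !mxE eqxx big1 => [|l _].
    by rewrite eq_sym oner_eq0.
  by rewrite B0 mulr0.
have mcol p q (i : 'I_q) (F : C -> 'M[C]_(p, q)) S : fun_ring S -> mxfun S F ->
    mxfun S (fun w => col i (F w)).
  by move=> hS' hF k l; apply: (fr_ext hS') (hF k i) => w; rewrite mxE.
split=> //; exists m; split; last split; last split=> //.
- move=> i; split; first exact: (mcol _ _ _ _ _ (fun_ring_holo_on Om)).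
  split; first exact: col_neq0 QY0.
  split; first by rewrite colE mulmxA (near_center TY) D0 mulmx0 mul0mx.
  exists (fun w => col i (L w)); split; first by apply/mholo_nearP; apply: mcol hL; exact: hS.
  split; first exact: col_neq0 LE.
  apply: near_mono TY => w TYw; rewrite [col i (Y w)]colE mulmxA -colE TYw.
  by apply/colP => k; rewrite mxE mul_mx_diag !mxE mulrC.
- apply/eqP; rewrite eqn_leq rank_leq_col /=.
  by rewrite -{1}(mxrank1 C r) -QY0 -mul_usub_mx mxrankM_maxr.
- move=> i j /andP[ij jr]; have [md _] := pmT.
  by apply: md; rewrite ij ltn_addr.
Qed.

Lemma mero_eq_of_form Y : biorthogonal_form Y ->
  mero_eq z0 (fun w => Dinv w *m V w *m T w *m Y w *m Dinv w) Dinv.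
Proof.
(* Off [z0] the product is [W Y Delta^-1 = Delta^-1 + K1], with [K1] the upper block of [K]. *)
move=> [K [hK QY]]; exists (fun w => - usubmx (K w)); split.
  apply/mholo_nearP => i j.
  apply: (fr_ext hS) (frM hS (fr_const hS (-1)) (hK (lshift s i) j)) => w.
  by rewrite !mxE mulN1r.
apply: near_mono2 VT QY => w VTw QYw wz; rewrite invVT_W //.
have /(congr1 usubmx) := QYw; rewrite mul_col_mx linearD /= !col_mxKu => ->.
rewrite -mul_usub_mx mulmxDl mul1mx -mulmxA mul_Delta_inv // mulmx1.
by rewrite opprD addrA subrr add0r.
Qed.

Lemma form_of_canonical Y : right_canonical Om z0 T m Y ->
  mero_eq z0 (fun w => Dinv w *m V w *m T w *m Y w *m Dinv w) Dinv ->
  biorthogonal_form Y.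
Proof.
move=> cY [G [/mholo_nearP hG eG]].
have hY : mxfun (hol z0) Y by apply: mholo_on_hol cY.1.
have [L [hL TY]] := right_canonical_factor openOm Om_z0 holT pmT rankT cY.
have hN : mxfun (hol z0) (fun w => (0 : 'M[C]_r) - G w).
  by apply: (mxfunB hS) => //; exact: (mxfun_const hS).
(* The upper block solves [W Y Delta^-1 = Delta^-1 - G]; the lower one comes from
   [T Y = L Delta]. *)
pose K w := col_mx (0 - G w) (E *m L w).
have hK : mxfun (hol z0) K.
  by apply: mxfun_col_mx => //; apply: (mxfunM hS) => //; exact: (mxfun_const hS).
exists K; split=> //; apply: near_fill.
- by apply: mxfun_cont; exact: (mxfunM hS).
- apply: mxfun_cont; apply: (mxfunD hS); first exact: (mxfun_const hS).
  exact: (mxfunM hS).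
apply: near_mono2 (near_and VT TY) eG => w [VTw TYw] Gw wz.
rewrite mul_col_mx -mulmxA TYw /K mul_col_mx mulmxA add_col_mx !add0r; congr col_mx.
rewrite -(Gw wz) invVT_W // opprB mulmxBl.
rewrite -(mulmxA (W w *m Y w)) mul_invDelta // mulmx1.
by rewrite addrC subrK.
Qed.

Lemma form_diff Y Y' : mholo_on Om Y -> mholo_on Om Y' ->
  biorthogonal_form Y -> biorthogonal_form Y' ->
  exists H, mholo_on Om H /\ forall w, Om w -> Y' w = Y w + H w *m D w.
Proof.
move=> hY hY' [K [hK QY]] [K' [hK' QY']].
pose G w := mxinv (Q w) *m (K' w - K w).
have hG : mxfun (hol z0) G.
  by apply: (mxfunM hS); [exact: mxfun_inv|exact: (mxfunB hS)].
have hSO := fun_ring_holo_on (fun w => Om w /\ w != z0).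
have GE : nearC z0 (fun w => Y' w - Y w = G w *m D w).
  apply: near_mono2 near_detQ (near_and QY QY') => w dQ [QYw QYw'].
  rewrite -[LHS]mul1mx -(mxinvmul dQ) -!mulmxA; congr (_ *m _).
  by rewrite mulmxBr QYw QYw' opprD addrACA subrr add0r mulmxBl.
(* Off [z0], [H] is forced by dividing by [Delta]; near [z0] this quotient agrees with the
   holomorphic [G]. *)
exists (fun w => if w == z0 then G z0 else (Y' w - Y w) *m Dinv w); split.
  apply: (mholo_on_patch (F := fun w => (Y' w - Y w) *m Dinv w)) => //.
    apply: (mxfunM hSO); last exact: mxfun_Delta_inv.
    by apply: (mxfunB hSO) => i j w [Omw _]; [exact: hY'|exact: hY].
  apply: near_mono GE => w -> wz.
  by rewrite -mulmxA mul_Delta_inv // mulmx1.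
move=> w _; have [->|wz] := eqVneq w z0.
  by rewrite -(near_center GE) addrC subrK.
by rewrite -mulmxA mul_invDelta // mulmx1 addrC subrK.
Qed.

Lemma form_add (Y Y' H : C -> 'M[C]_(r + s, r)) : mholo_on Om H ->
  (forall w, Om w -> Y' w = Y w + H w *m D w) ->
  biorthogonal_form Y -> biorthogonal_form Y'.
Proof.
move=> hH YE [K [hK QY]]; exists (fun w => K w + Q w *m H w); split.
  apply: (mxfunD hS) => //; apply: (mxfunM hS) => //.
  exact: mholo_on_hol hH.
have nOm : nearC z0 Om by exact: openOm.
apply: near_mono2 nOm QY => w Omw QYw.
by rewrite YE // mulmxDr QYw mulmxDl addrA mulmxA.
Qed.

Lemma holo_add (Y Y' H : C -> 'M[C]_(r + s, r)) : mholo_on Om Y -> mholo_on Om H ->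
  (forall w, Om w -> Y' w = Y w + H w *m D w) -> mholo_on Om Y'.
Proof.
move=> hY hH YE i j w Omw; have hSO := fun_ring_holo_on Om.
have hYH : mholo_on Om (fun w => Y w + H w *m D w).
  apply: (mxfunD hSO hY (mxfunM hSO hH _)); apply: mxfun_Delta hSO _ => v _.
  exact: cdiff_id.
have nOm : nearC w Om by exact: openOm.
by apply: cdiff_near (hYH i j w Omw) _; apply: near_mono nOm => v /YE ->.
Qed.

(* With [Q = Q0 (1 - N)] and [N] vanishing at [z0], the truncated Neumann series
   inverts [Q] up to [N ^+ (m 0).+1], which is divisible by [Delta]; unlike a local
   inverse of [Q], it is holomorphic on all of [Om]. *)
Lemma exists_form : exists Y, mholo_on Om Y /\ biorthogonal_form Y.
Proof.
have hSO := fun_ring_holo_on Om.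
(* [W] is only controlled near [z0]; [Delta^-1 V T] continues it holomorphically to all of [Om]. *)
pose Wg w := if w == z0 then W z0 else Dinv w *m V w *m T w.
have holWg : mholo_on Om Wg.
  have hSO' := fun_ring_holo_on (fun w => Om w /\ w != z0).
  apply: (mholo_on_patch (F := fun w => Dinv w *m V w *m T w)) holW _.
    by do 2?[apply: (mxfunM hSO')]; [exact: mxfun_Delta_inv|..];
       move=> i j w [Omw _]; [exact: holV|exact: holT].
  by apply: near_mono VT => w VTw wz; exact: invVT_W.
have WgE : nearC z0 (fun w => Wg w = W w).
  apply: near_mono VT => w VTw; rewrite /Wg.
  by case: eqVneq => [->|wz] //; exact: invVT_W.
pose Q0 := Q z0; pose Qg w := col_mx (Wg w) (E *m T w).
have holQg : mholo_on Om Qg.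
  apply: mxfun_col_mx => //; apply: (mxfunM hSO) => //; exact: (mxfun_const hSO).
pose N w : 'M[C]_(r + s) := 1 - mxinv Q0 *m Qg w.
have holN : mholo_on Om N.
  apply: (mxfunB hSO); first exact: (mxfun_const hSO).
  by apply: (mxfunM hSO) => //; exact: (mxfun_const hSO).
have N0 : N z0 = 0.
  by rewrite /N /Qg (near_center WgE) mxinvmul // subrr.
have [B [hB NB]] := pow_center0 (m 0%N) (mholo_on_hol openOm Om_z0 holN) N0.
(* [m 0] is the largest multiplicity. With [m 0 + 1] terms, [(1 - N) X = 1 - N^(m 0 + 1)], and the
   error is [(w - z0)^(m 0) B]. *)
pose X w := \sum_(i < (m 0%N).+1) N w ^+ i.
pose Y w := X w *m mxinv Q0 *m I0.
exists Y; split.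
  do 2!(apply: (mxfunM hSO); last exact: (mxfun_const hSO)).
  by apply: (mxfun_sum hSO) => i; exact: (mxfunX hSO).
(* [Q Y - I0 = - (w - z0)^(m 0) Q0 B Q0^-1 I0], and the scalar power splits as
   [diag((w - z0)^(m 0 - m i))] times [Delta]. *)
pose K w := 0 - Q0 *m B w *m mxinv Q0 *m I0 *m Delta r z0 (fun i => m 0%N - m i)%N w.
exists K; split.
  apply: (mxfunB hS); first exact: (mxfun_const hS).
  apply: (mxfunM hS); last exact: mxfun_Delta hS hol_id.
  do 2!(apply: (mxfunM hS); last exact: (mxfun_const hS)).
  by apply: (mxfunM hS) => //; exact: (mxfun_const hS).
apply: near_mono WgE => w Wgw.
have QE : Q w = Q0 *m (1 - N w).
  by rewrite /N subKr mulmxA mulmxinv // mul1mx /Qg Wgw.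
have NX : (1 - N w) *m X w = 1 - N w ^+ (m 0%N).+1.
  have := subrX1 (N w) (m 0%N).+1 => /(congr1 -%R).
  by rewrite opprB -mulNr opprB => ->.
have mD : (w - z0) ^+ m 0%N *: (1%:M : 'M[C]_r) =
    Delta r z0 (fun i => m 0%N - m i)%N w *m D w.
  rewrite mulmx_diag; apply/matrixP => i j; rewrite !mxE -exprD subnK ?mulr_natr //.
  by have [md _] := pmT; apply: md; rewrite /= ltn_addr.
rewrite /K QE /Y !mulmxA -(mulmxA Q0) NX NB mulmxBr mulmx1 !mulmxBl mulmxinv // mul1mx.
rewrite mul0mx sub0r; congr (_ - _).
rewrite -!mulmxA -mD -!scalemxAr -!scalemxAl -!scalemxAr.
by rewrite mulmx1 !mulmxA.
Qed.

Lemma inverse_of_form Y : mholo_on Om Y -> biorthogonal_form Y ->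
  mero_eq z0 (fun w => invmx (T w)) (fun w => Y w *m Dinv w *m V w).
Proof.
move=> hY [K [hK QY]].
(* [Y Delta^-1 V = Q^-1 ([Delta^-1 V; 0] + K V)], while [T^-1 = Q^-1 [Delta^-1 V; E]]. *)
exists (fun w => mxinv (Q w) *m (K w *m V w - col_mx 0 E)); split.
  apply/mholo_nearP; apply: (mxfunM hS); first exact: mxfun_inv.
  apply: (mxfunB hS); last exact: (mxfun_const hS).
  exact: (mxfunM hS).
apply: near_mono2 (near_and PT near_detP) (near_and near_detQ QY).
move=> w [PTw dP] [dQ QYw] wz.
(* This also shows that [T w] is invertible for [w != z0] near [z0], so [invmx] is the true inverse
   there and not its default value. *)
have TE : (mxinv (Q w) *m col_mx (Dinv w *m V w) E) *m T w = 1%:M.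
  rewrite -mulmxA -[RHS](mxinvmul dQ); congr (_ *m _).
  have -> : col_mx (Dinv w *m V w) E = block_mx (Dinv w) 0 0 1%:M *m P w.
    by rewrite mul_block_col !mul0mx mul1mx addr0 add0r.
  rewrite -mulmxA PTw mulmxA mulmx_block !mul0mx !mulmx0 mulmx1 !addr0 add0r.
  by rewrite mul_invDelta // -scalar_mx_block mul1mx.
have -> : invmx (T w) = mxinv (Q w) *m col_mx (Dinv w *m V w) E.
  have [_ uT] := mulmx1_unit TE.
  by rewrite -[LHS]mul1mx -TE mulmxK.
have -> : Y w = mxinv (Q w) *m (I0 + K w *m D w).
  by rewrite -QYw mulmxA mxinvmul // mul1mx.
rewrite -!mulmxA -mulmxBr; congr (_ *m _).
rewrite mulmxDl -mulmxA [D w *m _]mulmxA mul_Delta_inv // mul1mx.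
rewrite mul_col_mx mul1mx mul0mx addrAC addrC; congr (_ + _).
by rewrite !opp_col_mx add_col_mx subrr add0r oppr0.
Qed.

End Biorthogonality.

Theorem mainTheorem3 (R : realType) (Om : R[i] -> Prop) (z0 : R[i])
    (n r : nat) (T : R[i] -> 'M[R[i]]_n) (m : nat -> nat) :
  openC Om -> Om z0 -> mholo_on Om T ->
  ~ (forall z, Om z -> \det (T z) = 0) ->
  \det (T z0) = 0 ->
  r = (n - \rank (T z0))%N ->
  partial_multiplicities z0 T m ->
  forall V : R[i] -> 'M[R[i]]_(r, n),
  left_canonical Om z0 T m V ->
  (exists Y : R[i] -> 'M[R[i]]_(n, r),
     right_canonical Om z0 T m Y /\
     mero_eq z0 (fun z => Delta_inv r z0 m z *m V z *m T z *m Y z *m Delta_inv r z0 m z)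
                (fun z => Delta_inv r z0 m z) /\
     forall Y' : R[i] -> 'M[R[i]]_(n, r),
       (right_canonical Om z0 T m Y' /\
        mero_eq z0 (fun z => Delta_inv r z0 m z *m V z *m T z *m Y' z *m Delta_inv r z0 m z)
                   (fun z => Delta_inv r z0 m z))
       <-> (exists H : R[i] -> 'M[R[i]]_(n, r), mholo_on Om H /\
              forall z, Om z -> Y' z = Y z + H z *m Delta r z0 m z)) /\
  (forall Y : R[i] -> 'M[R[i]]_(n, r),
     right_canonical Om z0 T m Y ->
     mero_eq z0 (fun z => Delta_inv r z0 m z *m V z *m T z *m Y z *m Delta_inv r z0 m z)
                (fun z => Delta_inv r z0 m z) ->
     mero_eq z0 (fun z => invmx (T z)) (fun z => Y z *m Delta_inv r z0 m z *m V z)).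
Proof.
move=> openOm Om_z0 holT _ _ rE pmT V canV.
(* With [s] the rank of [T z0], the size becomes [r + s] and the block decompositions apply. *)
have [s [nE rankT]] : exists s, n = (r + s)%N /\ \rank (T z0) = s.
  by exists (\rank (T z0)); rewrite rE subnK ?rank_leq_row.
subst n; have holV := canV.1.
have [W [E [holW VT detP detQ]]] :=
  left_canonical_factor openOm Om_z0 holT pmT rankT canV.
have canon_of_form Y : mholo_on Om Y -> biorthogonal_form z0 m T W E Y ->
    right_canonical Om z0 T m Y /\
    mero_eq z0 (fun z => Delta_inv r z0 m z *m V z *m T z *m Y z *m Delta_inv r z0 m z)
               (fun z => Delta_inv r z0 m z).
  move=> holY formY; split; last exact: mero_eq_of_form VT _ formY.
  exact: right_canonical_of_form holY formY.
have form_of_canon Y : right_canonical Om z0 T m Y ->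
    mero_eq z0 (fun z => Delta_inv r z0 m z *m V z *m T z *m Y z *m Delta_inv r z0 m z)
               (fun z => Delta_inv r z0 m z) ->
    biorthogonal_form z0 m T W E Y.
  exact: form_of_canonical.
split; last first.
  move=> Y canY bioY; have formY := form_of_canon Y canY bioY.
  exact: inverse_of_form canY.1 formY.
have [Y [holY formY]] : exists Y, mholo_on Om Y /\ biorthogonal_form z0 m T W E Y.
  exact: exists_form.
have [canY bioY] := canon_of_form Y holY formY.
exists Y; split=> //; split=> // Y'; split=> [[canY' bioY']|[H [holH Y'E]]].
  have formY' := form_of_canon Y' canY' bioY'.
  exact: form_diff holY canY'.1 formY formY'.
apply: canon_of_form; first exact: holo_add holY holH Y'E.
exact: form_add holH Y'E formY.
Qed.
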